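(* Let $(M,F)$ be a smooth connected Finsler manifold satisfying the SC-condition, i.e. there is a nowhere-vanishing vector field $B=B^i(x)\,\partial/\partial x^i$ on $M$ with $B^h(x)\,C_{hij}(x,y)=0$ for all $i,j$ and all $(x,y)\in TM\setminus\{0\}$. Then $(M,F)$ is Riemannian if and only if its T-tensor $T_{hijk}$ vanishes.
   Context: A Finsler structure on a smooth manifold $M$ is a function $F:TM\to\mathbb R$ with $F\ge 0$, $F(0)=0$; $F$ is $C^\infty$ on the slit tangent bundle $TM\setminus\{0\}$; $F(x,\lambda y)=\lambda F(x,y)$ for $\lambda>0$; and $g_{ij}(x,y):=\frac12\frac{\partial^2F^2}{\partial y^i\partial y^j}$ is positive definite at each point of $TM\setminus\{0\}$. Notation: $\dot\partial_i=\partial/\partial y^i$; $(g^{ij})$ is the inverse of $(g_{ij})$; repeated indices are summed. Cartan tensor: $C_{ijk}:=\frac12\dot\partial_kg_{ij}$, and $C^i_{jk}:=g^{ri}C_{rjk}$. $(M,F)$ is Riemannian if $C_{ijk}=0$, equivalently $g_{ij}$ depends on $x$ only. Put $l_i:=\dot\partial_iF$. The vertical covariant derivative (Cartan connection) of the Cartan tensor is $C_{hij}|_k:=\dot\partial_kC_{hij}-C_{mij}C^m_{hk}-C_{hmj}C^m_{ik}-C_{him}C^m_{jk}$. The T-tensor is $$T_{hijk}=F\,C_{hij}|_k+C_{hij}l_k+C_{hik}l_j+C_{hjk}l_i+C_{ijk}l_h.$$ *)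

(* Defs.v *)
From HB Require Import structures.
From mathcomp Require Import all_boot all_order all_algebra.
From mathcomp Require Import all_classical all_reals all_analysis.
Set Implicit Arguments.
Unset Strict Implicit.
Unset Printing Implicit Defensive.
Import Order.TTheory GRing.Theory Num.Theory.
Import numFieldNormedType.Exports.
Local Open Scope classical_set_scope.
Local Open Scope ring_scope.

(* In finite dimension, [f] is C^k+1 on an open set iff it is (Frechet)
   differentiable there and all its directional derivatives are C^k.
   Only the germ of [f] at points of the open set [U] matters. *)
Fixpoint Ck_on (R : realType) (V W : normedModType R) (k : nat) (U : set V)
    (f : V -> W) : Prop :=
  if k is k'.+1 then
    (forall x, U x -> differentiable f x) /\
    (forall v, Ck_on k' U (fun x => 'D_v f x))
  else forall x, U x -> {for x, continuous f}.

Definition smooth_on (R : realType) (V W : normedModType R) (U : set V)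
    (f : V -> W) : Prop :=
  forall k, Ck_on k U f.

(* [coord a] is a homeomorphism from the open set [dom a] onto an open subset
   of R^n with inverse [param a]; the values of [coord a] and [param a] outside
   these two sets are irrelevant. *)
Record smoothManifold (R : realType) (n : nat) := SmoothManifold {
  points :> topologicalType;
  chart : Type;
  dom : chart -> set points;
  coord : chart -> points -> 'rV[R]_n;
  param : chart -> 'rV[R]_n -> points;
  points_hausdorff : hausdorff_space points;
  points_second_countable : @second_countable points;
  dom_cover : forall p, exists a, dom a p;
  dom_open : forall a, open (dom a);
  img_open : forall a, open (coord a @` dom a);
  coordK : forall a p, dom a p -> param a (coord a p) = p;
  coord_continuous : forall a p, dom a p -> {for p, continuous (coord a)};
  param_continuous : forall a x, (coord a @` dom a) x ->
    {for x, continuous (param a)};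
  transition_smooth : forall a b,
    smooth_on (coord a @` (dom a `&` dom b)) (coord b \o param a)
}.
Arguments dom {R n s} a.
Arguments coord {R n s} a p.
Arguments param {R n s} a x.

Section TangentSpace.
Context (R : realType) (n : nat) (M : smoothManifold R n).
Implicit Types (a b c : chart M) (p : M).

Definition img a : set 'rV[R]_n := coord a @` dom a.

Definition transition a b : 'rV[R]_n -> 'rV[R]_n := coord b \o param a.

(* A tangent vector at [p] is the family of its components in all the charts
   around [p], which transform by the differentials of the transition maps.
   Components in charts whose domain does not contain [p] are set to 0. *)
Definition tangent_pred p : {pred chart M -> 'rV[R]_n} := fun w =>
  `[< (forall a, ~ dom a p -> w a = 0) /\
      (forall a b, dom a p -> dom b p ->
         w b = 'D_(w a) (transition a b) (coord a p)) >].

Lemma transition_diff a b p : dom a p -> dom b p ->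
  differentiable (transition a b) (coord a p).
Proof.
move=> ap bp; have [+ _] := @transition_smooth R n M a b 1%N.
by apply; exists p.
Qed.

Fact tangent_submod p : submod_closed (tangent_pred p).
Proof.
split.
  apply/asboolP; split=> // a b ap bp.
  by rewrite deriveE ?linear0//; exact: transition_diff.
move=> k u v /asboolP[u0 uT] /asboolP[v0 vT]; apply/asboolP; split.
  by move=> a ap; rewrite /GRing.add /GRing.scale/= u0// v0// scaler0 addr0.
move=> a b ap bp; have df := transition_diff ap bp.
have -> : (k *: u + v) b = k *: u b + v b by [].
have -> : (k *: u + v) a = k *: u a + v a by [].
by rewrite deriveE// linearP/= (uT a b)// (vT a b)// !deriveE.
Qed.

HB.instance Definition _ p :=
  GRing.isSubmodClosed.Build R (chart M -> 'rV[R]_n) (tangent_pred p)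
    (tangent_submod p).

Definition tangent p := {w : chart M -> 'rV[R]_n | w \in tangent_pred p}.

HB.instance Definition _ p := [isSub of tangent p for @sval _ _].
HB.instance Definition _ p := [Choice of tangent p by <:].
HB.instance Definition _ p :=
  [SubChoice_isSubLmodule of tangent p by <:].

(* The components v^i of [v] in the chart [a]. *)
Definition tcomp a p (v : tangent p) : 'rV[R]_n := val v a.

Lemma transition_nbhs a b c p : dom a p -> dom b p ->
  \forall x \near coord a p,
    transition a c x = (transition b c \o transition a b) x.
Proof.
move=> ap bp.
have cp : {for coord a p, continuous (param a)}.
  by apply: param_continuous; exists p.
have : nbhs (coord a p) (param a @^-1` dom b).
  by apply: cp; rewrite coordK//; apply: open_nbhs_nbhs; split => //;
    exact: dom_open.
by apply: filterS => x /= bx; rewrite /transition/= coordK.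
Qed.

Lemma transitionE a b p : dom a p -> transition a b (coord a p) = coord b p.
Proof. by move=> ap; rewrite /transition/= coordK. Qed.

Definition tvec_family a p (y : 'rV[R]_n) : chart M -> 'rV[R]_n := fun b =>
  if `[< dom a p /\ dom b p >] then 'D_y (transition a b) (coord a p) else 0.

Fact tvec_subproof a p y : tvec_family a p y \in tangent_pred p.
Proof.
apply/asboolP; split=> [b nb|b c bp cp].
  by rewrite /tvec_family asboolF// => -[].
rewrite /tvec_family; have [ap|nap] := pselect (dom a p); last first.
  rewrite !asboolF; try by case.
  by rewrite deriveE ?linear0//; exact: transition_diff.
rewrite (asboolT (conj ap bp)) (asboolT (conj ap cp)).
have dab := transition_diff ap bp; have dbc := transition_diff bp cp.
rewrite (near_eq_derive _ (transition_nbhs c ap bp))//.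
have dbc' : differentiable (transition b c) (transition a b (coord a p)).
  by rewrite transitionE.
rewrite deriveE; last exact: differentiable_comp.
by rewrite diff_comp//= transitionE// !deriveE.
Qed.

(* The tangent vector y^i d/dx^i at [p] in the coordinates of the chart [a]. *)
Definition tvec a p (y : 'rV[R]_n) : tangent p :=
  exist _ (tvec_family a p y) (tvec_subproof a p y).

Lemma tcomp_tvec a p y : dom a p -> tcomp a (tvec a p y) = y.
Proof.
move=> ap; rewrite /tcomp/= /tvec_family asboolT//.
have aid : \forall x \near coord a p, transition a a x = id x.
  have : nbhs (coord a p) (img a).
    apply: open_nbhs_nbhs; split; first exact: img_open.
    by exists p.
  by apply: filterS => _ [q aq <-]; rewrite transitionE.
by rewrite (near_eq_derive _ aid) derive_id.
Qed.

Lemma tvec_tcomp a p (v : tangent p) : dom a p -> tvec a p (tcomp a v) = v.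
Proof.
move=> ap; apply: val_inj; apply/funext => b /=.
have /asboolP[v0 vT] := valP v.
rewrite /tvec_family; have [bp|nbp] := pselect (dom b p).
  by rewrite asboolT// -vT.
by rewrite asboolF ?v0// => -[].
Qed.

End TangentSpace.

Arguments tcomp {R n M} a {p} v.

(* Local tensor components, computed from the coordinate expression
   [L x y = F(x, y)] of the Finsler function. *)
Section LocalTensors.
Context (R : realType) (n : nat).
Implicit Types (L f : 'rV[R]_n -> 'rV[R]_n -> R) (h i j k : 'I_n).

Definition ypartial i f : 'rV[R]_n -> 'rV[R]_n -> R := fun x y =>
  'D_(delta_mx 0 i) (f x) y.

Definition metric L i j : 'rV[R]_n -> 'rV[R]_n -> R := fun x y =>
  2^-1 * ypartial i (ypartial j (fun x y => L x y ^+ 2)) x y.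

Definition metric_mx L (x y : 'rV[R]_n) : 'M[R]_n :=
  \matrix_(i, j) metric L i j x y.

Definition cartan L i j k : 'rV[R]_n -> 'rV[R]_n -> R := fun x y =>
  2^-1 * ypartial k (metric L i j) x y.

(* C^i_{jk} *)
Definition cartan_up L i j k : 'rV[R]_n -> 'rV[R]_n -> R := fun x y =>
  \sum_(r < n) invmx (metric_mx L x y) r i * cartan L r j k x y.

(* C_{hij}|_k *)
Definition cartan_vcov L h i j k : 'rV[R]_n -> 'rV[R]_n -> R := fun x y =>
  ypartial k (cartan L h i j) x y
  - \sum_(m < n) cartan L m i j x y * cartan_up L m h k x y
  - \sum_(m < n) cartan L h m j x y * cartan_up L m i k x y
  - \sum_(m < n) cartan L h i m x y * cartan_up L m j k x y.

Definition T_tensor L h i j k : 'rV[R]_n -> 'rV[R]_n -> R := fun x y =>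
  L x y * cartan_vcov L h i j k x y
  + cartan L h i j x y * ypartial k L x y
  + cartan L h i k x y * ypartial j L x y
  + cartan L h j k x y * ypartial i L x y
  + cartan L i j k x y * ypartial h L x y.

End LocalTensors.

Definition local_expr (R : realType) (n : nat) (M : smoothManifold R n)
    (F : forall p : M, tangent p -> R) (a : chart M) (x y : 'rV[R]_n) : R :=
  F (param a x) (tvec a (param a x) y).

(* The coordinate domain of the slit tangent bundle over the chart [a]. *)
Definition slit (R : realType) (n : nat) (M : smoothManifold R n)
    (a : chart M) : set ('rV[R]_n * 'rV[R]_n) :=
  [set z | img a z.1 /\ z.2 != 0].

Record finslerStructure (R : realType) (n : nat) (M : smoothManifold R n) :=
    FinslerStructure {
  finsler :> forall p : M, tangent p -> R;
  finsler_ge0 : forall p (v : tangent p), 0 <= finsler v;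
  finsler0 : forall p : M, finsler (0 : tangent p) = 0;
  finsler_smooth : forall a : chart M,
    smooth_on (slit a) (fun z => local_expr finsler a z.1 z.2);
  finslerZ : forall p (v : tangent p) (t : R), 0 < t ->
    finsler (t *: v) = t * finsler v;
  finsler_posdef : forall (a : chart M) (x y : 'rV[R]_n), slit a (x, y) ->
    forall v : 'rV[R]_n, v != 0 ->
      0 < \sum_(i < n) \sum_(j < n)
            metric (local_expr finsler a) i j x y * v 0 i * v 0 j
}.

Record vectorField (R : realType) (n : nat) (M : smoothManifold R n) :=
    VectorField {
  field_at :> forall p : M, tangent p;
  field_smooth : forall a : chart M,
    smooth_on (img a) (fun x => tcomp a (field_at (param a x)))
}.

Definition SC_condition (R : realType) (n : nat) (M : smoothManifold R n)
    (F : finslerStructure M) : Prop :=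
  exists B : vectorField M,
    (forall p : M, B p != 0) /\
    (forall (a : chart M) (x y : 'rV[R]_n), slit a (x, y) ->
      forall i j : 'I_n,
        \sum_(h < n) tcomp a (B (param a x)) 0 h
                     * cartan (local_expr F a) h i j x y = 0).

Definition riemannian (R : realType) (n : nat) (M : smoothManifold R n)
    (F : finslerStructure M) : Prop :=
  forall (a : chart M) (x y : 'rV[R]_n), slit a (x, y) ->
    forall i j k : 'I_n, cartan (local_expr F a) i j k x y = 0.

Definition T_tensor_vanishes (R : realType) (n : nat) (M : smoothManifold R n)
    (F : finslerStructure M) : Prop :=
  forall (a : chart M) (x y : 'rV[R]_n), slit a (x, y) ->
    forall h i j k : 'I_n, T_tensor (local_expr F a) h i j k x y = 0.

(* Main.v *)
Require Import Defs.
From mathcomp Require Import all_boot all_order all_algebra.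
From mathcomp Require Import all_classical all_reals all_analysis.
Local Open Scope classical_set_scope.
Set Implicit Arguments.
Unset Strict Implicit.
Unset Printing Implicit Defensive.
Import Order.TTheory GRing.Theory Num.Theory.
Import numFieldNormedType.Exports.
Local Open Scope ring_scope.

(** The question is pointwise in the base point: fix a chart and [x], put
   [b = B(x)], which is nonzero, and regard [L = F(x, .)] as a smooth function
   on the nonzero vectors with [b^h C_hij = 0].

   Contract the T-tensor with [b^h].  The derivative term [b^h d_k C_hij] is
   the derivative of the zero function [b^h C_hij]; the correction terms contain
   [b^h C_hmj], [b^h C_him] or [b^h C^m_hk], which all vanish (the last one
   because [C_rhk = C_hrk]); so do the terms [b^h C_hij l_k] and its two
   permutations.  What is left is
     [b^h T_hijk = (b^h l_h) C_ijk]   (lemma [T_formula_contract]).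
   So if [T = 0], then [C = 0] wherever the derivative [b^h l_h] of [L] along
   [b] is nonzero, and it remains to see that this happens on a dense set.
   Suppose [C_ijk(y) <> 0].  By continuity [C_ijk <> 0] near [y], hence
   [b^h l_h = 0] near [y], hence the derivative of [L ^ 2 / 2] along [b]
   vanishes near [y].  Differentiating it once more gives [g_ij b^i b^j = 0] at
   [y] (lemma [metric_along_eq0]), which contradicts positive definiteness.

   Conversely, if [C] vanishes on the slit tangent bundle, whose fibres are
   open, then so does its vertical derivative, and every term of [T]
   contains [C] or this derivative.

   The calculus behind this is: iterated directional derivatives of a smooth
   function are continuous, which requires that the class [Ck_on] is stable
   under products (for [L ^ 2]) and under restriction to a fibre (smoothness of
   [F] is given jointly in [x] and [y]); and second derivatives commute
   ([Schwarz]), which gives the symmetry of [g_ij] in [i, j] and with it that of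
   [C_ijk] in its first two indices. *)

(** * Calculus of C^k functions on an open set *)

Section DeriveAlong.
Context (R : realType) (V V' W : normedModType R).
Context (f : V' -> W) (j : V -> V') (v : V) (v' : V') (y : V).
Context (jE : forall h : R, j (h *: v + y) = h *: v' + j y).

Let quotientE : (fun h : R => h^-1 *: (f (j (h *: v + y)) - f (j y)))
  = (fun h : R => h^-1 *: (f (h *: v' + j y) - f (j y))).
Proof. by apply/funext => h; rewrite jE. Qed.

(** A map [j] that carries the line through [y] directed by [v] affinely to the
   line through [j y] directed by [v'] also carries the difference quotients:
   this covers translations, parametrized lines and slices of a product, with
   no differentiability assumption. *)
Lemma derivable_along : derivable f (j y) v' -> derivable (f \o j) y v.
Proof. by rewrite /derivable /= -quotientE. Qed.

Lemma derive_along : 'D_v (f \o j) y = 'D_v' f (j y).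
Proof. by rewrite /derive /= -quotientE. Qed.

End DeriveAlong.

Section CkFunctions.
Context (R : realType).

Lemma near_eq_differentiable (V W : normedModType R) (f g : V -> W) (x : V) :
  (\forall z \near x, f z = g z) -> differentiable f x -> differentiable g x.
Proof.
move=> fg df; have [cf ef] := (diff_locallyP _ _).1 df.
have fx : f x = g x by exact: nbhs_singleton fg.
have eg : g \o shift x = cst (g x) + 'd f x +o_ (0 : V) id.
  apply/eqaddoP => e e0; move/eqaddoP : ef => /(_ e e0) ef.
  have fg0 : \forall z \near (0 : V), f (z + x) = g (z + x).
    move: fg; rewrite (near_shift 0 x) /=.
    by apply: filterS => z /=; rewrite subr0.
  by apply: filterS2 fg0 ef => z ez; rewrite !fctE /= ez fx.
have dg : 'd g x = 'd f x :> (V -> W) by exact: diff_unique.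
by apply/diff_locallyP; rewrite dg.
Qed.

(** The recursion in [Ck_on] produces derivatives such as that of a product
   that agree with the expected formula on [U] only; this lemma lets one replace
   them. *)
Lemma Ck_on_eq (V W : normedModType R) (k : nat) (U : set V) (f g : V -> W) :
  open U -> (forall x, U x -> f x = g x) -> Ck_on k U f -> Ck_on k U g.
Proof.
move=> oU; elim: k f g => [|k IH] f g fg /=.
  move=> cf x Ux; have nU : \forall z \near x, f z = g z.
    by near do apply: fg; exact: open_nbhs_nbhs.
  rewrite /prop_for /continuous_at -(fg x Ux).
  exact: cvg_trans (near_eq_cvg nU) (cf x Ux).
move=> [df cf]; have nU x : U x -> \forall z \near x, f z = g z.
  by move=> Ux; near do apply: fg; exact: open_nbhs_nbhs.
split=> [x Ux|v]; first exact: near_eq_differentiable (nU x Ux) (df x Ux).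
by apply: IH (cf v) => x Ux; exact: near_eq_derive (nU x Ux).
Unshelve. all: by end_near. Qed.

Lemma Ck_onW (V W : normedModType R) (k : nat) (U : set V) (f : V -> W) :
  Ck_on k.+1 U f -> Ck_on k U f.
Proof.
elim: k f => [|k IH] f [df cf]; first by move=> x /df/differentiable_continuous.
by split=> // v; exact: IH.
Qed.

Lemma Ck_onD (V W : normedModType R) (k : nat) (U : set V) (f g : V -> W) :
  open U -> Ck_on k U f -> Ck_on k U g -> Ck_on k U (fun x => f x + g x).
Proof.
move=> oU; elim: k f g => [|k IH] f g.
  by move=> cf cg x Ux; apply: continuousD; [exact: cf|exact: cg].
move=> [df cf] [dg cg]; split=> [x Ux|v].
  by apply: differentiableD; [exact: df|exact: dg].
apply: (Ck_on_eq oU _ (IH _ _ (cf v) (cg v))) => x Ux /=.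
by rewrite -deriveD//; apply: diff_derivable; [exact: df|exact: dg].
Qed.

Lemma Ck_onM (V : normedModType R) (k : nat) (U : set V) (f g : V -> R) :
  open U -> Ck_on k U f -> Ck_on k U g -> Ck_on k U (fun x => f x * g x).
Proof.
move=> oU; elim: k f g => [|k IH] f g.
  by move=> cf cg x Ux; apply: continuousM; [exact: cf|exact: cg].
move=> cf1 cg1; have [df cf] := cf1; have [dg cg] := cg1.
split=> [x Ux|v].
  by apply: differentiableM; [exact: df|exact: dg].
apply: (Ck_on_eq oU _ (Ck_onD oU (IH _ _ (Ck_onW cf1) (cg v))
                                 (IH _ _ (Ck_onW cg1) (cf v)))) => x Ux /=.
by rewrite -[RHS]/('D_v (f * g) x) deriveM//; apply: diff_derivable;
  [exact: df|exact: dg].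
Qed.

Lemma Ck_on_cst (V W : normedModType R) (k : nat) (U : set V) (c : W) :
  Ck_on k U (fun=> c).
Proof.
elim: k c => [|k IH] c /=; first by move=> x _; exact: cst_continuous.
split=> [x _|v]; first exact: differentiable_cst.
have -> : 'D_v (fun=> c : W) = fun=> 0.
  by apply/funext => x; exact: derive_cst.
exact: IH.
Qed.

(** On [V1 * V2], the derivative along [(0, v)] is the partial derivative in the
   second variable along [v]. *)
Lemma Ck_on_slice (V1 V2 W : normedModType R) (k : nat) (S : set (V1 * V2))
    (f : V1 * V2 -> W) (x : V1) :
  Ck_on k S f -> Ck_on k [set y | S (x, y)] (fun y => f (x, y)).
Proof.
have dpair (y : V2) : differentiable (fun y => (x, y)) y.
  by apply: differentiable_pair.
elim: k f => [|k IH] f /=.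
  move=> cf y Sy; apply: (@continuous_comp _ _ _ (fun y => (x, y)) f).
    exact: differentiable_continuous.
  exact: cf.
move=> [df cf]; split=> [y Sy|v].
  by apply: (@differentiable_comp _ _ _ _ (fun y => (x, y)) f) => //; exact: df.
have -> : 'D_v (fun y => f (x, y)) = fun y => 'D_(0, v) f (x, y).
  apply/funext => y.
  apply: (@derive_along R V2 (V1 * V2)%type W f (fun y => (x, y))) => h.
  by rewrite -[RHS]/(h *: 0 + x, h *: v + y) scaler0 add0r.
exact: IH (cf (0, v)).
Qed.

End CkFunctions.

(** * Symmetry of second derivatives *)

Section Schwarz.
Context (R : realType) (V : normedModType R).
Implicit Types (f : V -> R) (u v y w : V) (U : set V).

Lemma is_derive_line f u y (t : R) : derivable f (y + t *: u) u ->
  is_derive t 1 (fun t => f (y + t *: u)) ('D_u f (y + t *: u)).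
Proof.
have jE (h : R) : y + (h *: (1 : R) + t) *: u = h *: u + (y + t *: u).
  by rewrite scalerDl -[h *: (1 : R)]/(h * 1) mulr1 addrCA.
move=> df; apply: DeriveDef.
  exact: (@derivable_along R R V R f (fun t => y + t *: u)) df.
exact: (@derive_along R R V R f (fun t => y + t *: u)).
Qed.

Lemma MVT_line f u y (s : R) : 0 <= s ->
  (forall t : R, 0 <= t <= s -> derivable f (y + t *: u) u) ->
  exists2 c : R, 0 <= c <= s & f (y + s *: u) - f y = s * 'D_u f (y + c *: u).
Proof.
move=> s0 df.
have dF (t : R) : 0 <= t <= s ->
    is_derive t 1 (fun t => f (y + t *: u)) ('D_u f (y + t *: u)).
  by move=> /df; exact: is_derive_line.
have [|//|c cs /=] := @MVT_segment R (fun t => f (y + t *: u))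
    (fun t => 'D_u f (y + t *: u)) 0 s s0.
- by move=> t; rewrite in_itv /= => /andP[? ?]; apply: dF; rewrite !ltW.
- apply: derivable_within_continuous => t; rewrite in_itv /= => ts.
  by have [] := dF t ts.
by rewrite scale0r addr0 subr0 mulrC; exists c.
Qed.

(** The second difference of [f] over a parallelogram is a mixed second
   derivative at some point of it: apply the mean value theorem along [u] to
   the increment of [f] by [s *: v], then along [v] to the derivative of [f]
   along [u].  The left-hand side is symmetric in [u] and [v], the right-hand
   side is not, whence Schwarz's theorem. *)
Lemma second_difference f u v y (s : R) : 0 <= s ->
  (forall a b : R, 0 <= a <= s -> 0 <= b <= s ->
     derivable f (y + a *: u + b *: v) u /\
     derivable ('D_u f) (y + a *: u + b *: v) v) ->
  exists a b : R, [/\ 0 <= a <= s, 0 <= b <= s &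
    f (y + s *: u + s *: v) - f (y + s *: u) - (f (y + s *: v) - f y)
    = s * (s * 'D_v ('D_u f) (y + a *: u + b *: v))].
Proof.
move=> s0 df.
have ss : 0 <= s <= s by rewrite s0 lexx.
have s00 : (0 : R) <= 0 <= s by rewrite lexx s0.
have df0 (a : R) : 0 <= a <= s -> derivable f (y + a *: u) u.
  by move=> /df /(_ s00) []; rewrite scale0r addr0.
have [|a as_ ea] :=
    @MVT_line (fun z => f (z + s *: v) - f z) u y s s0.
  move=> t ts; apply: derivableB; last exact: df0.
  apply: (@derivable_along R V V R f (+%R^~ (s *: v)) u u) => [h|].
    by rewrite /= !addrA.
  exact: (df t s ts ss).1.
have [|b bs eb] := @MVT_line ('D_u f) v (y + a *: u) s s0.
  by move=> t ts; have [] := df a t as_ ts.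
exists a, b; split=> //; rewrite ea -eb; congr (_ * _).
rewrite deriveB; last 2 first.
- apply: (@derivable_along R V V R f (+%R^~ (s *: v)) u u) => [h|].
    by rewrite /= !addrA.
  exact: (df a s as_ ss).1.
- exact: df0.
congr (_ - _); rewrite -[LHS]/('D_u (f \o (+%R^~ (s *: v))) _).
by apply: derive_along => h; rewrite /= !addrA.
Qed.

Lemma no_common_half_ball (a b d : R) :
  `|a - d| < `|a - b| / 2 -> `|b - d| < `|a - b| / 2 -> False.
Proof.
move=> ad bd; have := ltrD ad bd; rewrite -splitr (distrC b) ltNge.
move=> /negP; apply; exact: ler_distD.
Qed.

Lemma near_dist_lt (g : V -> R) y (e : R) : {for y, continuous g} -> 0 < e ->
  \forall z \near y, `|g y - g z| < e.
Proof. by move=> cg e0; exact: (cvgrPdist_lt _ _).1 cg e e0. Qed.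

(** If the mixed derivatives differed at [y], then by continuity they would
   take disjoint sets of values near [y], whereas the second difference over a
   small parallelogram is, up to the factor [s ^ 2], a value of each. *)
Lemma Schwarz U f u v y : open U -> Ck_on 2 U f -> U y ->
  'D_u ('D_v f) y = 'D_v ('D_u f) y.
Proof.
move=> oU [df d2f] Uy; apply: contrapT => /eqP neq.
set A := 'D_u _ _ in neq; set B := 'D_v _ _ in neq.
have e0 : 0 < `|A - B| / 2 by rewrite divr_gt0 // normr_gt0 subr_eq0.
have [_ /(_ u y Uy) cA] := d2f v; have nA := near_dist_lt cA e0.
have [_ /(_ v y Uy) cB] := d2f u; have nB := near_dist_lt cB e0.
have nU : \forall z \near y, U z by exact: open_nbhs_nbhs.
have : \forall z \near y, [/\ U z, `|A - 'D_u ('D_v f) z| < `|A - B| / 2 &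
    `|B - 'D_v ('D_u f) z| < `|A - B| / 2].
  apply: filterS3 nU nA nB => z Uz hA hB.
  by split; [exact Uz|exact hA|exact hB].
move=> /nbhs_ballP[r /= r0 Br].
(* All points of the parallelogram lie at distance at most
   [s * (`|u| + `|v|) < r] from [y]; the summand 1 makes [m] nonzero. *)
set m := `|u| + `|v| + 1.
have m0 : 0 < m by rewrite ltr_wpDl // addr_ge0.
set s := r / 2 / m.
have s0 : 0 < s by rewrite !divr_gt0.
have near_sq (a b : R) : 0 <= a <= s -> 0 <= b <= s ->
    ball y r (y + a *: u + b *: v).
  move=> /andP[a0 as_] /andP[b0 bs].
  rewrite -ball_normE /ball_ /= -addrA opprD addNKr normrN.
  apply: le_lt_trans (ler_normD _ _) _; rewrite !normrZ !ger0_norm //.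
  apply: (@le_lt_trans _ _ (s * m)).
    rewrite /m !mulrDr mulr1 -[leLHS]addr0 lerD ?(ltW s0) //.
    by rewrite lerD // ler_wpM2r.
  by rewrite /s divfK ?gt_eqF // ltr_pdivrMr // ltr_pMr // ltr1n.
have [a [b [as_ bs e1]]] : exists a b : R, [/\ 0 <= a <= s, 0 <= b <= s &
    f (y + s *: u + s *: v) - f (y + s *: u) - (f (y + s *: v) - f y)
    = s * (s * 'D_v ('D_u f) (y + a *: u + b *: v))].
  apply: second_difference (ltW s0) _ => a b as_ bs.
  have [Uz _ _] := Br _ (near_sq _ _ as_ bs).
  by split; apply: diff_derivable; [exact: df|have [+ _] := d2f u; exact].
have [c [d [cs ds e2]]] : exists a b : R, [/\ 0 <= a <= s, 0 <= b <= s &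
    f (y + s *: v + s *: u) - f (y + s *: v) - (f (y + s *: u) - f y)
    = s * (s * 'D_u ('D_v f) (y + a *: v + b *: u))].
  apply: second_difference (ltW s0) _ => a' b' as' bs'; rewrite addrAC.
  have [Uz _ _] := Br _ (near_sq _ _ bs' as').
  by split; apply: diff_derivable; [exact: df|have [+ _] := d2f v; exact].
have e3 : f (y + s *: u + s *: v) - f (y + s *: u) - (f (y + s *: v) - f y)
        = f (y + s *: v + s *: u) - f (y + s *: v) - (f (y + s *: u) - f y).
  by rewrite (addrAC y (s *: v)) !opprD !opprK addrACA.
rewrite (addrAC y (c *: v)) in e2.
have := etrans (esym e1) (etrans e3 e2).
move=> /(mulfI (lt0r_neq0 s0)) /(mulfI (lt0r_neq0 s0)) eqD.
have [_ _ hB] := Br _ (near_sq _ _ as_ bs).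
have [_ hA _] := Br _ (near_sq _ _ ds cs).
by rewrite eqD in hB; exact: no_common_half_ball hA hB.
Qed.

End Schwarz.

(** * The Finsler tensors at a fixed base point *)

Section LinearCombinations.
Context (R : realType) (n : nat).

Lemma derive_lincomb (V : normedModType R) (c : 'I_n -> R) (f : 'I_n -> V -> R)
    (v y : V) : (forall i, derivable (f i) y v) ->
  'D_v (fun z => \sum_i c i * f i z) y = \sum_i c i * 'D_v (f i) y.
Proof.
move=> df.
have -> : (fun z => \sum_i c i * f i z) = \sum_i (c i \*: f i).
  by apply/funext => z; rewrite fct_sumE.
rewrite derive_sum => [|i]; last exact: derivableZ.
by apply: eq_bigr => i _; rewrite deriveZ.
Qed.

Lemma open_neq0 : open [set y : 'rV[R]_n | y != 0].
Proof.
rewrite (_ : [set y | _] = ~` [set 0]).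
  apply/closed_openC/accessible_closed_set1/hausdorff_accessible.
  exact: norm_hausdorff.
by apply/seteqP; split=> y /= /eqP.
Qed.

End LinearCombinations.

Section TFormula.
Context (R : comPzRingType) (n : nat).
Implicit Types (b l : 'I_n -> R) (C Cup : 'I_n -> 'I_n -> 'I_n -> R)
  (dC : 'I_n -> 'I_n -> 'I_n -> 'I_n -> R).

(** The T-tensor at a point in terms of the values there of [F], [l_i], [C_ijk],
   [d_k C_hij] and [C^i_jk].  Keeping these as independent variables separates
   the algebra of the T-tensor from the calculus. *)
Definition T_formula (F : R) l C dC Cup h i j k : R :=
  F * (dC h i j k
       - \sum_(m < n) C m i j * Cup m h k
       - \sum_(m < n) C h m j * Cup m i k
       - \sum_(m < n) C h i m * Cup m j k)
  + C h i j * l k + C h i k * l j + C h j k * l i + C i j k * l h.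

Lemma T_formula_eq0 F l C dC Cup h i j k :
  (forall i j k, C i j k = 0) -> dC h i j k = 0 ->
  T_formula F l C dC Cup h i j k = 0.
Proof.
move=> C0 dC0; rewrite /T_formula dC0 !C0.
rewrite !big1 => [|m _|m _|m _]; rewrite ?C0 ?mul0r //.
by rewrite !subr0 mulr0 !addr0.
Qed.

(** Of all the terms, only [C_ijk l_h] contracts [b] with neither [C] nor [dC]
   nor [Cup]. *)
Lemma T_formula_contract b F l C dC Cup i j k :
  (forall i j, \sum_h b h * C h i j = 0) ->
  \sum_h b h * dC h i j k = 0 ->
  (forall m, \sum_h b h * Cup m h k = 0) ->
  \sum_h b h * T_formula F l C dC Cup h i j k = (\sum_h b h * l h) * C i j k.
Proof.
move=> bC bdC bCup.
have bCl p q c : \sum_h b h * (C h p q * c) = 0.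
  under eq_bigr do rewrite mulrA.
  by rewrite -big_distrl /= bC mul0r.
have bsumC (p q c : 'I_n -> _) :
    \sum_h b h * (\sum_m C h (p m) (q m) * c m) = 0.
  under eq_bigr do rewrite big_distrr /=.
  by rewrite exchange_big big1 // => m _; exact: bCl.
have bsumCup : \sum_h b h * (\sum_m C m i j * Cup m h k) = 0.
  under eq_bigr do rewrite big_distrr /=.
  rewrite exchange_big big1 // => m _ /=.
  under eq_bigr do rewrite mulrCA.
  by rewrite -big_distrr /= bCup mulr0.
rewrite /T_formula.
under eq_bigr do
  rewrite !mulrDr !mulrN !(mulrCA _ F) (mulrCA _ (C i j k)).
rewrite !big_split /= !bCl !sumrN -!big_distrr /= bdC bsumCup.
rewrite (bsumC id (fun=> j) (fun m => Cup m i k)).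
rewrite (bsumC (fun=> i) id (fun m => Cup m j k)).
by rewrite !mulr0 !subr0 !addr0 add0r mulrC.
Qed.

End TFormula.

Section FixedBasePoint.
Context (R : realType) (n : nat) (L : 'rV[R]_n -> 'rV[R]_n -> R) (x : 'rV[R]_n).
Let U : set 'rV[R]_n := [set y | y != 0].
Context (L_smooth : smooth_on U (L x)).

Let oU : open U := @open_neq0 R n.

Lemma ypartial_Ck k i (f : 'rV[R]_n -> 'rV[R]_n -> R) :
  Ck_on k.+1 U (f x) -> Ck_on k U (ypartial i f x).
Proof. by move=> [_]; apply. Qed.

Lemma sqr_smooth : smooth_on U (fun y => L x y ^+ 2).
Proof.
move=> k; rewrite (_ : (fun _ => _) = (fun y => L x y * L x y)).
  exact: Ck_onM.
by apply/funext => y; rewrite expr2.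
Qed.

Lemma metric_smooth i j : smooth_on U (metric L i j x).
Proof.
move=> k.
have d2 : Ck_on k U (ypartial i (ypartial j (fun x y => L x y ^+ 2)) x).
  exact/ypartial_Ck/ypartial_Ck/sqr_smooth.
exact: (Ck_onM oU (Ck_on_cst k U (2^-1 : R)) d2).
Qed.

Lemma cartan_smooth i j k : smooth_on U (cartan L i j k x).
Proof.
move=> m.
have dg : Ck_on m U (ypartial k (metric L i j) x).
  exact/ypartial_Ck/metric_smooth.
exact: (Ck_onM oU (Ck_on_cst m U (2^-1 : R)) dg).
Qed.

Lemma smooth_derivable (f : 'rV[R]_n -> R) y v :
  smooth_on U f -> U y -> derivable f y v.
Proof.
by move=> /(_ 1%N)[df _] Uy; apply: diff_derivable; exact: df.
Qed.

Lemma near_nonzero (P : 'rV[R]_n -> Prop) y :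
  (forall z, U z -> P z) -> U y -> \forall z \near y, P z.
Proof. by move=> UP Uy; apply: filterS UP _; exact: open_nbhs_nbhs. Qed.

Lemma derive_eq_nonzero (f g : 'rV[R]_n -> R) v y :
  (forall z, U z -> f z = g z) -> U y -> 'D_v f y = 'D_v g y.
Proof.
move=> fg Uy; apply: near_eq_derive.
exact: (@near_nonzero (fun z => f z = g z)).
Qed.

Lemma derive_eq0_nonzero (f : 'rV[R]_n -> R) v y :
  (forall z, U z -> f z = 0) -> U y -> 'D_v f y = 0.
Proof.
by move=> f0 Uy; rewrite (@derive_eq_nonzero f (cst 0)) ?derive_cst.
Qed.

Lemma metricC i j y : U y -> metric L i j x y = metric L j i x y.
Proof.
move=> Uy; apply: (congr1 ( *%R 2^-1)).
exact: (Schwarz (delta_mx 0 i) (delta_mx 0 j) oU (@sqr_smooth 2%N) Uy).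
Qed.

Lemma cartanC i j k y : U y -> cartan L i j k x y = cartan L j i k x y.
Proof.
move=> Uy; apply: (congr1 ( *%R 2^-1)).
have dg := @derive_eq_nonzero _ _ (delta_mx 0 k) y (fun z => @metricC i j z).
exact (dg Uy).
Qed.

Lemma T_tensorE h i j k y : T_tensor L h i j k x y =
  T_formula (L x y) (fun i => ypartial i L x y) (fun i j k => cartan L i j k x y)
    (fun h i j k => ypartial k (cartan L h i j) x y)
    (fun i j k => cartan_up L i j k x y) h i j k.
Proof. by []. Qed.

Lemma cartan_eq0_T_tensor_eq0 :
  (forall y, U y -> forall i j k, cartan L i j k x y = 0) ->
  forall y, U y -> forall h i j k, T_tensor L h i j k x y = 0.
Proof.
move=> C0 y Uy h i j k; rewrite T_tensorE; apply: T_formula_eq0 (C0 y Uy) _.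
exact: derive_eq0_nonzero (fun z Uz => C0 z Uz h i j) Uy.
Qed.

Section SC.
Context (b : 'rV[R]_n).
Context (bC : forall y, U y -> forall i j,
  \sum_h b 0 h * cartan L h i j x y = 0).

(** [b] is contracted with the second index of [C_rhk], hence the use of
   [cartanC]. *)
Lemma SC_cartan_up y m k : U y -> \sum_h b 0 h * cartan_up L m h k x y = 0.
Proof.
move=> Uy; rewrite /cartan_up.
under eq_bigr do rewrite big_distrr /=.
rewrite exchange_big big1 // => r _ /=.
under eq_bigr => h _ do rewrite mulrCA (cartanC r h k Uy).
by rewrite -big_distrr /= (bC Uy) mulr0.
Qed.

Lemma SC_cartan_derive y i j k : U y ->
  \sum_h b 0 h * ypartial k (cartan L h i j) x y = 0.
Proof.
move=> Uy.
rewrite -(@derive_lincomb _ _ _ (fun h => b 0 h) (fun h => cartan L h i j x)).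
  exact: derive_eq0_nonzero (fun z Uz => bC Uz i j) Uy.
by move=> h; apply: smooth_derivable Uy; exact: cartan_smooth.
Qed.

Lemma SC_T_tensor y i j k : U y ->
  \sum_h b 0 h * T_tensor L h i j k x y =
  (\sum_h b 0 h * ypartial h L x y) * cartan L i j k x y.
Proof.
move=> Uy; under eq_bigr do rewrite T_tensorE.
apply: (@T_formula_contract _ _ (fun h => b 0 h)).
- exact: bC.
- exact: SC_cartan_derive.
- by move=> m; exact: SC_cartan_up.
Qed.

(** [g_ij b^i b^j] is half the second derivative of [L ^ 2] along [b], and the
   first one is [2 L (b^h l_h)]. *)
Lemma metric_along_eq0 y : U y ->
  (\forall z \near y, \sum_h b 0 h * ypartial h L x z = 0) ->
  \sum_i \sum_j metric L i j x y * b 0 i * b 0 j = 0.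
Proof.
move=> Uy dL0.
have dE0 : \forall z \near y,
    \sum_j b 0 j * ypartial j (fun x y => L x y ^+ 2) x z = 0.
  near=> z.
  have Uz : U z by near: z; exact: near_nonzero Uy.
  under eq_bigr => j _.
    rewrite /ypartial (_ : (fun y => _) = L x ^+ 2); last first.
      by apply/funext => w; rewrite fctE.
    rewrite deriveX; last exact: smooth_derivable.
    rewrite mulrC -[X in X * _]/(_ * _) -mulrA (mulrC _ (b 0 j)).
    over.
  rewrite -big_distrr /= -[X in _ * X]/(\sum_j b 0 j * ypartial j L x z).
  by rewrite (near dL0 z) ?mulr0.
have regroup (p d u v : R) : p * d * u * v = u * p * (v * d).
  by rewrite [RHS]mulrACA [RHS]mulrC mulrA.
rewrite big1 // => i _.
have -> : \sum_j metric L i j x y * b 0 i * b 0 j =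
    b 0 i * 2^-1 * \sum_j b 0 j *
      'D_(delta_mx 0 i) (ypartial j (fun x y => L x y ^+ 2) x) y.
  rewrite big_distrr; apply: eq_bigr => j _ /=.
  exact: regroup.
rewrite -derive_lincomb => [|j]; last first.
  apply: smooth_derivable Uy => k; exact/ypartial_Ck/sqr_smooth.
by rewrite (near_eq_derive _ dE0) derive_cst mulr0.
Unshelve. all: by end_near. Qed.

Context (metric_pos : forall y, U y ->
  0 < \sum_i \sum_j metric L i j x y * b 0 i * b 0 j).

(** The identity [(b^h l_h) C_ijk = 0] says nothing at a point [y] where [L] has
   zero derivative along [b]; but if [C_ijk] were nonzero at [y], this derivative
   would be zero on a whole neighbourhood of [y], so that the second derivative
   of [L ^ 2] along [b] would vanish at [y] too. *)
Lemma T_tensor_eq0_cartan_eq0 :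
  (forall y, U y -> forall h i j k, T_tensor L h i j k x y = 0) ->
  forall y, U y -> forall i j k, cartan L i j k x y = 0.
Proof.
move=> T0 y Uy i j k; apply: contrapT => /eqP C0.
have Cn0 : \forall z \near y, cartan L i j k x z != 0.
  have cC : {for y, continuous (cartan L i j k x)} :=
    @cartan_smooth i j k 0%N y Uy.
  exact: (cC _ (open_nbhs_nbhs (conj (@open_neq R 0) C0))).
suff dL0 : \forall z \near y, \sum_h b 0 h * ypartial h L x z = 0.
  by have := metric_pos Uy; rewrite metric_along_eq0 ?ltxx.
apply: filterS2 (near_nonzero (fun z => id) Uy) Cn0 => z Uz Cz.
apply: (mulIf Cz); rewrite mul0r -SC_T_tensor // big1 // => h _.
by rewrite (T0 z Uz) mulr0.
Qed.

End SC.
End FixedBasePoint.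

(** * Finsler manifolds *)

Section Tangent.
Context (R : realType) (n : nat) (M : smoothManifold R n).

Lemma tcomp_eq0 (a : chart M) (p : M) (v : tangent p) :
  dom a p -> tcomp a v = 0 -> v = 0.
Proof.
move=> ap v0; rewrite -(tvec_tcomp v ap) v0.
by rewrite -[RHS](tvec_tcomp (0 : tangent p) ap).
Qed.

Lemma dom_param (a : chart M) x : img a x -> dom a (param a x).
Proof. by case=> p ap <-; rewrite coordK. Qed.

End Tangent.

Lemma local_expr_smooth (R : realType) (n : nat) (M : smoothManifold R n)
    (F : finslerStructure M) (a : chart M) (x : 'rV[R]_n) : img a x ->
  smooth_on [set y | y != 0] (local_expr F a x).
Proof.
move=> ax k; have := Ck_on_slice x (finsler_smooth F a k).
have -> : [set y | slit a (x, y)] = [set y | y != 0].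
  by apply/seteqP; split=> y // [].
by [].
Qed.

Theorem theorem3p15 (R : realType) (n : nat) (M : smoothManifold R n)
    (F : finslerStructure M) (M_connected : connected [set: M])
    (F_SC : SC_condition F) :
  riemannian F <-> T_tensor_vanishes F.
Proof.
have [B [B0 BC]] := F_SC.
split=> [C0 a x y [/= ax y0]|T0 a x y [/= ax y0]].
  by apply: cartan_eq0_T_tensor_eq0 y0 => z z0; exact: C0.
have b0 : tcomp a (B (param a x)) != 0.
  apply/eqP => b0; move/eqP: (B0 (param a x)); apply.
  exact: tcomp_eq0 (dom_param ax) b0.
apply: (T_tensor_eq0_cartan_eq0 (local_expr_smooth F ax)
  (b := tcomp a (B (param a x)))) y0 => z z0 *.
- exact: BC.
- exact: finsler_posdef.
- exact: T0.
Qed.
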